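(* Let $K$ be a field of characteristic zero and let $(a_0,b_0)\in\mathbb{N}_0\times\mathbb{N}_0$. If $(a_0,b_0)=(k,0)+j(2,1)$ with integers $k>0$ and $j>0$, then there exist $(1,-2)$-homogeneous polynomials $R,G\in K[x,y]$ such that $$\operatorname{st}_{1,-2}(R)=(k,0),\qquad \operatorname{en}_{1,-2}(R)=(a_0,b_0),\qquad [G,R]=R^2,$$ and $R$ is not a monomial.
   Context: $\mathbb{N}_0=\{0,1,2,\dots\}$. $[P,Q]=\partial_xP\,\partial_yQ-\partial_xQ\,\partial_yP$. A polynomial is $(1,-2)$-homogeneous if $i-2j$ is constant over all $(i,j)$ in its support (the set of exponents $(i,j)$ of monomials $x^iy^j$ with nonzero coefficient). For a nonzero $(1,-2)$-homogeneous $R$, the support lies on a line of direction $(2,1)$; $\operatorname{st}_{1,-2}(R)$ (resp. $\operatorname{en}_{1,-2}(R)$) is the support point with smallest (resp. largest) second coordinate. *)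

(* Defs.v *)
From HB Require Import structures.
From mathcomp Require Import all_boot all_order all_algebra.
From mathcomp Require Import mpoly.

Set Implicit Arguments.
Unset Strict Implicit.
Unset Printing Implicit Defensive.

Import GRing.Theory.
Local Open Scope ring_scope.

(* K[x,y] is {mpoly K[2]}: the variable of index 0 is x, that of index 1 is y. *)
Notation ix := (ord0 : 'I_2).
Notation iy := (ord_max : 'I_2).

Definition bracket (K : fieldType) (P Q : {mpoly K[2]}) : {mpoly K[2]} :=
  mderiv ix P * mderiv iy Q - mderiv ix Q * mderiv iy P.

Definition support2 (K : fieldType) (P : {mpoly K[2]}) : seq (nat * nat) :=
  [seq (m ix, m iy) | m : 'X_{1..2} <- msupp P].

Definition homog12 (K : fieldType) (P : {mpoly K[2]}) : Prop :=
  exists d : int, forall p : nat * nat,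
    p \in support2 P -> p.1%:Z - 2 * p.2%:Z = d.

(* st and en are relations because they have no value at the zero polynomial;
   for a (1,-2)-homogeneous polynomial they hold of at most one point (st_uniq,
   en_uniq), and they hold of no point exactly when the polynomial is 0. *)
Definition is_st (K : fieldType) (P : {mpoly K[2]}) (p : nat * nat) : Prop :=
  p \in support2 P /\ forall q, q \in support2 P -> (p.2 <= q.2)%N.

Definition is_en (K : fieldType) (P : {mpoly K[2]}) (p : nat * nat) : Prop :=
  p \in support2 P /\ forall q, q \in support2 P -> (q.2 <= p.2)%N.

Definition is_monomial (K : fieldType) (P : {mpoly K[2]}) : Prop :=
  exists (c : K) (m : 'X_{1..2}), c != 0 /\ P = c *: 'X_[m].

Lemma homog12_inj (K : fieldType) (P : {mpoly K[2]}) (p q : nat * nat) :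
  homog12 P -> p \in support2 P -> q \in support2 P -> p.2 = q.2 -> p = q.
Proof.
case: p q => [p1 p2] [q1 q2] [d hd] /hd /= hp /hd /= hq e2.
rewrite -e2 -hp in hq; move/addIr: hq => [->].
by rewrite e2.
Qed.

Lemma st_uniq (K : fieldType) (P : {mpoly K[2]}) (p q : nat * nat) :
  homog12 P -> is_st P p -> is_st P q -> p = q.
Proof.
move=> hP [hp lp] [hq lq]; apply: (homog12_inj hP hp hq).
by apply/eqP; rewrite eqn_leq lp ?lq.
Qed.

Lemma en_uniq (K : fieldType) (P : {mpoly K[2]}) (p q : nat * nat) :
  homog12 P -> is_en P p -> is_en P q -> p = q.
Proof.
move=> hP [hp lp] [hq lq]; apply: (homog12_inj hP hp hq).
by apply/eqP; rewrite eqn_leq lp ?lq.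
Qed.

(* Main.v *)
(** With [u = 1 + x^2 y] one has [[x, u] = x^2], so the Leibniz rule gives
    [[x^a u^m, x^b u^n] = (a n - m b) x^(a+b+1) u^(m+n-1)].  For
    [(a, m) = (k-1, j+1)] and [(b, n) = (k, j)] this is [-(k+j) (x^k u^j)^2], so
    [R = x^k u^j] and [G = -(k+j)^-1 x^(k-1) u^(j+1)] work. *)
Require Import Defs.
From HB Require Import structures.
From mathcomp Require Import all_boot all_order all_algebra.
From mathcomp Require Import mpoly.
From mathcomp Require Import ring.

Set Implicit Arguments.
Unset Strict Implicit.
Unset Printing Implicit Defensive.

Import GRing.Theory.
Local Open Scope ring_scope.

Section PowerFamily.
Variable K : fieldType.

Definition upoly : {mpoly K[2]} := 1 + 'X_ix ^+ 2 * 'X_iy.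

(** Both witnesses lie in this family: [R] is a member and [G] a scalar multiple of one. *)
Definition xu (a n : nat) : {mpoly K[2]} := 'X_ix ^+ a * upoly ^+ n.

(** Exponents of the binomial terms of [xu a n]: they start at (a, 0) and advance by (2, 1). *)
Definition xu_mnm (a i : nat) : 'X_{1..2} :=
  (U_(ix) *+ (a + i * 2) + U_(iy) *+ i)%MM.

Lemma xu_mnm_ix a i : xu_mnm a i ix = (a + i * 2)%N.
Proof. by rewrite mnmDE !mulmnE !mnm1E /= mul1n mul0n addn0. Qed.

Lemma xu_mnm_iy a i : xu_mnm a i iy = i.
Proof. by rewrite mnmDE !mulmnE !mnm1E /= mul1n mul0n. Qed.

Lemma xuE a n : xu a n = \sum_(i < n.+1) 'X_[xu_mnm a i] *+ 'C(n, i).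
Proof.
rewrite /xu /upoly exprDn mulr_sumr; apply: eq_bigr => i _.
rewrite expr1n mul1r mulrnAr exprMn mulrA -exprM -exprD.
by rewrite /xu_mnm mpolyXD -!mpolyXn mulnC.
Qed.

Lemma mcoeff_xu a n i : (xu a n)@_(xu_mnm a i) = ('C(n, i))%:R.
Proof.
(* The exponent of y alone separates the binomial terms, so no two of them merge. *)
have mnm_eq l : (xu_mnm a l == xu_mnm a i) = (l == i).
  apply/eqP/eqP => [/(congr1 (fun m : 'X_{1..2} => m iy))|->//].
  by rewrite !xu_mnm_iy.
rewrite xuE raddf_sum /=.
under eq_bigr => l _ do rewrite mcoeffMn mcoeffX mnm_eq.
have [lt_in|le_ni] := ltnP i n.+1.
  rewrite (bigD1 (Ordinal lt_in)) //= eqxx big1 ?addr0 // => l.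
  by rewrite -val_eqE /= => /negbTE ->; rewrite mul0rn.
(* For i > n the binomial coefficient is zero, and no summand has this exponent. *)
rewrite bin_small // big1 // => l _.
by rewrite (ltn_eqF (leq_trans (ltn_ord l) le_ni)) mul0rn.
Qed.

Lemma msupp_xu a n m : m \in msupp (xu a n) ->
  exists2 i, (i <= n)%N & m = xu_mnm a i.
Proof.
rewrite xuE => /msupp_sum_le /flattenP [s /mapP [i _ ->]].
rewrite -scaler_nat => /msuppZ_le; rewrite msuppX inE => /eqP ->.
by exists i; rewrite // -ltnS.
Qed.

Lemma support2_xu a n p :
  p \in support2 (xu a n) -> p.1 = (a + p.2 * 2)%N /\ (p.2 <= n)%N.
Proof. by case/mapP => m /msupp_xu [i le_in ->] -> /=; rewrite xu_mnm_ix xu_mnm_iy. Qed.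

Lemma support2Z (c : K) (P : {mpoly K[2]}) p :
  p \in support2 (c *: P) -> p \in support2 P.
Proof. by case/mapP => m /msuppZ_le mP ->; apply/mapP; exists m. Qed.

(** Along the support, (a + 2i) - 2i = a. The scalar lets one statement serve both [R] and [G]. *)
Lemma homog12_scale_xu c a n : homog12 (c *: xu a n).
Proof.
exists a%:Z => p /support2Z /support2_xu [-> _].
by rewrite PoszD PoszM; ring.
Qed.

Lemma is_monomial_support2 (P : {mpoly K[2]}) p q :
  is_monomial P -> p \in support2 P -> q \in support2 P -> p = q.
Proof.
case=> c [m [c_neq0 ->]]; rewrite /support2 msuppMCX //= !inE.
by move=> /eqP -> /eqP ->.
Qed.

Lemma mderiv_exp i (P : {mpoly K[2]}) n :
  mderiv i (P ^+ n.+1) = (n.+1)%:R * P ^+ n * mderiv i P.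
Proof.
elim: n => [|n IHn]; first by rewrite expr1 expr0 !mul1r.
by rewrite exprS mderivM IHn (exprS P n); ring.
Qed.

Lemma mderivX1 (i l : 'I_2) : mderiv i ('X_l : {mpoly K[2]}) = (i == l)%:R.
Proof.
rewrite mderivX mnm1E eq_sym; case: eqP => [->|_]; last by rewrite scale0r.
by rewrite scale1r -[X in (X - _)%MM]add0m addmK mpolyX0.
Qed.

Lemma mderiv_ix_upoly : mderiv ix upoly = 2 * 'X_ix * 'X_iy.
Proof.
by rewrite /upoly mderivD mderivM mderiv_exp -mpolyC1 mderivC !mderivX1 /=; ring.
Qed.

Lemma mderiv_iy_upoly : mderiv iy upoly = 'X_ix ^+ 2.
Proof.
by rewrite /upoly mderivD mderivM mderiv_exp -mpolyC1 mderivC !mderivX1 /=; ring.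
Qed.

Lemma bracket_xu a n :
  bracket (xu a n.+2) (xu a.+1 n.+1) = - (a + n.+2)%:R * xu a.+1 n.+1 ^+ 2.
Proof.
have dxx : mderiv ix 'X_ix = 1 :> {mpoly K[2]} by rewrite mderivX1.
have dyx : mderiv iy 'X_ix = 0 :> {mpoly K[2]} by rewrite mderivX1.
rewrite /bracket /xu !(mderivM _ ('X_ix ^+ a)) !(mderivM _ ('X_ix ^+ a.+1)).
rewrite !(mderiv_exp _ upoly) mderiv_ix_upoly mderiv_iy_upoly.
(* [mderiv_exp] needs a successor exponent; for a = 0 the factor x^0 is the constant 1, with zero
   derivatives. *)
case: a => [|a]; last by rewrite !mderiv_exp dxx dyx !exprS; ring.
rewrite expr0 -mpolyC1 !mderivC mpolyC1.
by rewrite !mderiv_exp dxx dyx !exprS; ring.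
Qed.

Lemma bracketZl c (P Q : {mpoly K[2]}) : bracket (c *: P) Q = c *: bracket P Q.
Proof. by rewrite /bracket !mderivZ -scalerAl -scalerAr scalerBr. Qed.

Hypothesis K_char0 : [pchar K] =i pred0.

(** In characteristic zero the positive integer C(n, i) stays nonzero in K. *)
Lemma mem_support2_xu a n i :
  (i <= n)%N -> ((a + i * 2)%N, i) \in support2 (xu a n).
Proof.
move=> le_in; apply/mapP; exists (xu_mnm a i);
  last by rewrite xu_mnm_ix xu_mnm_iy.
by rewrite mcoeff_msupp mcoeff_xu ((pcharf0P K).1 K_char0) -lt0n bin_gt0.
Qed.

End PowerFamily.

Theorem proposition2p8 (K : fieldType) (K_char0 : [pchar K] =i pred0)
    (a0 b0 k j : nat) (k_gt0 : (0 < k)%N) (j_gt0 : (0 < j)%N)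
    (a0b0 : (a0, b0) = (k + j * 2, 0 + j * 1)%N) :
  exists R G : {mpoly K[2]},
    [/\ homog12 R, homog12 G, is_st R (k, 0%N) & is_en R (a0, b0)] /\
    bracket G R = R ^+ 2 /\ ~ is_monomial R.
Proof.
rewrite a0b0 add0n muln1.
(* From here k = a + 1 and j = n + 1, hence k + j = a + n + 2. *)
case: k j k_gt0 j_gt0 {a0 b0 a0b0} => [|a] [|n] // _ _.
have st_mem : (a.+1, 0%N) \in support2 (xu K a.+1 n.+1).
  by have := mem_support2_xu K_char0 a.+1 (leq0n n.+1); rewrite addn0.
have en_mem := mem_support2_xu K_char0 a.+1 (leqnn n.+1).
exists (xu K a.+1 n.+1), (- (a + n.+2)%:R^-1 *: xu K a n.+2); split; last split.
- split.
  + by rewrite -[xu _ _ _]scale1r; apply: homog12_scale_xu.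
  + exact: homog12_scale_xu.
  + by split.
  + by split=> // q /support2_xu [].
- rewrite bracketZl bracket_xu mulNr scaleNr scalerN opprK mulr_natl -scaler_nat.
  (* The integer a + n + 2 is a successor, hence invertible in characteristic zero. *)
  by rewrite scalerA mulVf ?scale1r // ((pcharf0P K).1 K_char0) addnS.
(* A monomial has a single support point, but the two endpoints have y-exponents 0 and n + 1. *)
- by move/is_monomial_support2/(_ st_mem en_mem).
Qed.
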